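(* Let $k\le n$ be positive integers and $w\in\mathcal{W}_{n,k}$. Let $1\times w\in\mathcal{W}_{n+1,k+1}$ be the word obtained by increasing every letter of $w$ by $1$ and prepending the letter $1$. For a polynomial $f(x_1,\dots,x_N)$ write $f(\mathbf{x}_N^* ) = f(x_N,\dots,x_1)$. Then $$\mathfrak{S}_{1\times w}(\mathbf{x}_{n+1}^* )\big|_{x_{n+1}=0} = \mathfrak{S}_w(\mathbf{x}_n^* ).$$
   Context: $\mathcal{W}_{n,k}$ is the set of words $w = w_1\cdots w_n\in[k]^n$ in which each of $1,\dots,k$ appears. A position $j$ is initial in $w$ if $w_{j'}\neq w_j$ for all $j'<j$. Schubert polynomials for words: $\mathfrak{S}_\pi$ for $\pi\in S_N$ is the classical Schubert polynomial ($\mathfrak{S}_{w_0}=x_1^{N-1}\cdots x_{N-1}$, $\mathfrak{S}_{\pi s_i}=\partial_i\mathfrak{S}_\pi$ if $\pi(i)>\pi(i+1)$, where $\partial_i f=(f-s_if)/(x_i-x_{i+1})$). $S_n$ acts on polynomials by $\pi.x_i = x_{\pi(i)}$. For $w\in[k]^n$ with $m$ distinct letters, $\mathrm{std}(w)\in S_{n+k-m}$ keeps letters in initial positions, replaces letters in non-initial positions from left to right by $k+1,\dots,k+n-m$, and appends the letters of $[k]$ missing from $w$ in increasing order. $\mathrm{conv}(w)$ is the unique word with no subword $i\cdots j\cdots i$ ($i\neq j$) having the same letter multiplicities as $w$ and the same left-to-right order of initial letters. If the initial letters of $w$ are $a_1,\dots,a_m$ left to right, $\sigma(w)\in S_n$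 has one-line notation listing the positions of the occurrences of $a_1$ in increasing order, then of $a_2$, etc. Then $\mathfrak{S}_w := \sigma(w)^{-1}.\mathfrak{S}_{\mathrm{std}(\mathrm{conv}(w))}\in\mathbb{Z}[x_1,\dots,x_n]$. *)

(* Defs.v *)
From mathcomp Require Import all_boot all_order all_fingroup all_algebra.
From mathcomp Require Import zify ring.
From mathcomp Require Export mpoly.

Set Implicit Arguments.
Unset Strict Implicit.
Unset Printing Implicit Defensive.

Import GRing.Theory.
Local Open Scope ring_scope.

(* Letters, positions and variable indices are numbered from 0.               *)

Definition surj_words (n k : nat) : {set n.-tuple 'I_k} :=
  [set w : n.-tuple 'I_k | [forall a, a \in w]].

Definition initial n k (w : n.-tuple 'I_k) (j : 'I_n) : bool :=
  [forall j' : 'I_n, (j' < j)%N ==> (tnth w j' != tnth w j)].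

Definition initial_letters n k (w : n.-tuple 'I_k) : seq 'I_k :=
  [seq tnth w j | j <- enum 'I_n & initial w j].

Definition distinct_letters n k (w : n.-tuple 'I_k) : nat := size (undup w).

Definition one_times n k (w : n.-tuple 'I_k) : n.+1.-tuple 'I_k.+1 :=
  [tuple of ord0 :: [tuple of map (lift ord0) w]].

Lemma one_times_surj n k (w : n.-tuple 'I_k) :
  w \in surj_words n k -> one_times w \in surj_words n.+1 k.+1.
Proof.
rewrite !inE => /forallP hw; apply/forallP => a; rewrite inE.
case: (unliftP ord0 a) => [b ->|->]; last by rewrite eqxx.
by apply/orP; right; apply: map_f; apply: hw.
Qed.

Lemma initial_letters_inj n k (w : n.-tuple 'I_k) :
  {in [pred j | initial w j] &, injective (tnth w)}.
Proof.
move=> i j; rewrite !inE => /forallP hi /forallP hj e; apply/val_inj => /=.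
case: (ltngtP i j) => // lt; first by have := hj i; rewrite lt e eqxx.
by have := hi j; rewrite lt e eqxx.
Qed.

Lemma initial_letters_uniq n k (w : n.-tuple 'I_k) : uniq (initial_letters w).
Proof.
rewrite map_inj_in_uniq ?(filter_uniq _ (enum_uniq _)) // => i j.
rewrite !mem_filter => /andP[hi _] /andP[hj _].
exact: initial_letters_inj.
Qed.

Lemma mem_initial_letters n k (w : n.-tuple 'I_k) : initial_letters w =i w.
Proof.
move=> a; apply/mapP/idP => [[j _ ->]|/tnthP [j ej]]; first exact: mem_tnth.
have h : tnth w j == a by rewrite ej.
case: (@arg_minnP _ j (fun i => tnth w i == a) val h) => i /eqP ei min.
exists i => //; rewrite mem_filter mem_enum andbT; apply/forallP => i'.
apply/implyP => lt; rewrite ei; apply/negP => /min.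
by rewrite leqNgt lt.
Qed.

Lemma perm_initial_letters n k (w : n.-tuple 'I_k) :
  perm_eq (initial_letters w) (undup w).
Proof.
apply: uniq_perm; rewrite ?initial_letters_uniq ?undup_uniq // => a.
by rewrite mem_undup mem_initial_letters.
Qed.

Lemma size_initial_letters n k (w : n.-tuple 'I_k) :
  size (initial_letters w) = distinct_letters w.
Proof. exact: perm_size (perm_initial_letters w). Qed.

Lemma line_lt N (s : seq nat) (hs : perm_eq s (iota 0 N)) (i : 'I_N) :
  (nth 0%N s i < N)%N.
Proof.
have: nth 0%N s i \in s.
  by rewrite mem_nth // (perm_size hs) size_iota.
by rewrite (perm_mem hs) mem_iota.
Qed.

Lemma line_inj N (s : seq nat) (hs : perm_eq s (iota 0 N)) :
  injective (fun i : 'I_N => Ordinal (line_lt hs i)).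
Proof.
move=> i j [] /eqP; rewrite nth_uniq ?(perm_size hs) ?size_iota //.
  by move/eqP/val_inj.
by rewrite (perm_uniq hs) iota_uniq.
Qed.

Definition line_perm N (s : seq nat) (hs : perm_eq s (iota 0 N)) : 'S_N :=
  perm (@line_inj N s hs).

Lemma line_permE N (s : seq nat) (hs : perm_eq s (iota 0 N)) (i : 'I_N) :
  line_perm hs i = nth 0%N s i :> nat.
Proof. by rewrite permE. Qed.

Definition std_line n k (w : n.-tuple 'I_k) : seq nat :=
  [seq if initial w j then val (tnth w j)
       else (k + #|[set j' : 'I_n | (j' < j)%N && ~~ initial w j']|)%N
     | j <- enum 'I_n]
  ++ [seq val a | a <- enum 'I_k & a \notin w].

Lemma card_initial n k (w : n.-tuple 'I_k) :
  #|[set j | initial w j]| = distinct_letters w.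
Proof.
rewrite -size_initial_letters size_map cardE; apply: perm_size.
apply: uniq_perm; rewrite ?enum_uniq ?(filter_uniq _ (enum_uniq _)) // => j.
by rewrite (mem_filter _ _ (enum 'I_n)) !mem_enum inE andbT.
Qed.

Lemma card_noninitial n k (w : n.-tuple 'I_k) :
  #|[set j | ~~ initial w j]| = (n - distinct_letters w)%N.
Proof.
have <- : ~: [set j | initial w j] = [set j | ~~ initial w j].
  by apply/setP => j; rewrite !inE.
by rewrite cardsCs setCK card_ord card_initial.
Qed.

Lemma distinct_letters_le n k (w : n.-tuple 'I_k) :
  (distinct_letters w <= n)%N /\ (distinct_letters w <= k)%N.
Proof.
split; first by rewrite -{2}(size_tuple w) size_undup.
rewrite /distinct_letters -(card_uniqP (undup_uniq w)).
by rewrite (leq_trans (max_card _)) ?card_ord.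
Qed.

Lemma std_line_perm n k (w : n.-tuple 'I_k) :
  perm_eq (std_line w) (iota 0 (n + k - distinct_letters w)).
Proof.
have [len lek] := distinct_letters_le w.
pose rk (j : 'I_n) := #|[set j' : 'I_n | (j' < j)%N && ~~ initial w j']|.
have rk_lt (i j : 'I_n) : (i < j)%N -> ~~ initial w i -> (rk i < rk j)%N.
  move=> lt hi; apply: proper_card; apply/properP; split.
    by apply/subsetP => l; rewrite !inE => /andP[/ltn_trans -> // ->].
  by exists i; rewrite !inE ?lt ?hi ?ltnn.
have rk_ub j : ~~ initial w j -> (rk j < n - distinct_letters w)%N.
  move=> hj; rewrite -card_noninitial; apply: proper_card.
  apply/properP; split; first by apply/subsetP => l; rewrite !inE => /andP[].
  by exists j; rewrite !inE ?ltnn.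
have szmiss : size [seq a <- enum 'I_k | a \notin w] = (k - distinct_letters w)%N.
  rewrite -[LHS]addn0 -(subnn (distinct_letters w)) addnBA //.
  congr (_ - _)%N; rewrite addnC.
  have -> : distinct_letters w = count (mem w) (enum 'I_k).
    rewrite -size_filter; apply: perm_size; apply: uniq_perm.
    - exact: undup_uniq.
    - exact: filter_uniq (enum_uniq _).
    - by move=> a; rewrite mem_undup mem_filter mem_enum andbT.
  rewrite size_filter -[RHS](size_enum_ord k).
  exact: count_predC.
have Us : uniq (std_line w).
  rewrite cat_uniq; apply/and3P; split.
  - rewrite map_inj_in_uniq ?enum_uniq // => i j _ _.
    case: ifPn => hi; case: ifPn => hj.
    + by move/val_inj; apply: initial_letters_inj.
    + by move=> e; have := ltn_ord (tnth w i); rewrite e ltnNge leq_addr.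
    + by move=> e; have := ltn_ord (tnth w j); rewrite -e ltnNge leq_addr.
    + move/addnI => e; apply/val_inj => /=; case: (ltngtP i j) => // lt.
        by have := rk_lt _ _ lt hi; rewrite /rk e ltnn.
      by have := rk_lt _ _ lt hj; rewrite /rk e ltnn.
  - apply/hasPn => x /mapP[a]; rewrite mem_filter => /andP[aw _] ->{x}.
    apply/mapP => -[j _] /=; case: ifPn => hj.
      by move/val_inj => ea; move: aw; rewrite ea mem_tnth.
    by move=> e; have := ltn_ord a; rewrite e ltnNge leq_addr.
  - rewrite map_inj_uniq ?(filter_uniq _ (enum_uniq _)) //; exact: val_inj.
have sz : size (std_line w) = (n + k - distinct_letters w)%N.
  by rewrite size_cat size_map size_enum_ord size_map szmiss addnBA.
have sub : {subset std_line w <= iota 0 (n + k - distinct_letters w)}.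
  move=> x; rewrite mem_iota add0n /= mem_cat => /orP[]/mapP[j].
    move=> _ ->; case: ifPn => hj.
      by apply: leq_trans (ltn_ord _) _; rewrite addnC -addnBA ?leq_addr.
    by rewrite addnC -[X in (_ < X)%N]addnBAC // ltn_add2r rk_ub.
  by move=> _ ->; apply: leq_trans (ltn_ord _) _; rewrite addnC -addnBA ?leq_addr.
apply: uniq_perm => //; first exact: iota_uniq.
by case: (uniq_min_size Us sub); rewrite // sz size_iota.
Qed.

Definition std n k (w : n.-tuple 'I_k) : 'S_(n + k - distinct_letters w) :=
  line_perm (std_line_perm w).

Definition convex_word n k (v : n.-tuple 'I_k) : bool :=
  [forall i, forall j, (i != j) ==> ~~ subseq [:: i; j; i] v].

Definition is_conv n k (w v : n.-tuple 'I_k) : bool :=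
  [&& convex_word v, perm_eq v w & initial_letters v == initial_letters w].

Definition conv_line n k (w : n.-tuple 'I_k) : seq 'I_k :=
  flatten [seq nseq (count_mem a w) a | a <- initial_letters w].

Fixpoint firsts (T : eqType) (s : seq T) : seq T :=
  if s is x :: s' then x :: filter (predC1 x) (firsts s') else [::].

Lemma mem_firsts (T : eqType) (s : seq T) : firsts s =i s.
Proof.
elim: s => //= x s IHs y; rewrite !inE mem_filter IHs /=.
by case: (y == x).
Qed.

Lemma initial_lettersE n k (w : n.-tuple 'I_k) : initial_letters w = firsts w.
Proof.
elim: n w => [|n IHn] w.
  by rewrite (tuple0 w) /initial_letters; case: (enum _) => // -[].
case/tupleP: w => x t; rewrite /initial_letters enum_ordSl /=.
have -> : initial [tuple of x :: t] ord0.
  by apply/forallP => i; apply/implyP.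
rewrite /= tnth0 -IHn /initial_letters.
move: (enum 'I_n) => e; rewrite filter_map -map_comp.
congr (_ :: _); rewrite filter_map -filter_predI.
rewrite (eq_map (g := tnth t)); last by move=> j /=; rewrite tnthS.
congr map; apply: eq_filter => j; rewrite /=.
apply/forallP/andP => [h|[xj /forallP h] i].
  split; first by have := h ord0; rewrite tnth0 tnthS eq_sym.
  by apply/forallP => i; have := h (lift ord0 i); rewrite !tnthS.
case: (unliftP ord0 i) => [i' ->|->]; rewrite ?tnth0 !tnthS; first exact: h.
by rewrite eq_sym xj implybT.
Qed.

Lemma convex_firsts (T : eqType) (s : seq T) :
  (forall i j, i != j -> ~~ subseq [:: i; j; i] s) ->
  s = flatten [seq nseq (count_mem a s) a | a <- firsts s].
Proof.
elim: s => //= x s IHs cvx.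
have cvxs i j : i != j -> ~~ subseq [:: i; j; i] s.
  move=> ne; apply: contra (cvx i j ne) => h.
  exact: subseq_trans h (subseq_cons _ _).
rewrite eqxx add1n /=; congr (_ :: _); rewrite {1}(IHs cvxs).
have congE r : x \notin r ->
    [seq nseq ((x == a) + count_mem a s) a | a <- r]
    = [seq nseq (count_mem a s) a | a <- r].
  move=> xr; apply/eq_in_map => a ar; case: eqP => // e.
  by rewrite -e in ar; rewrite ar in xr.
have xF : x \notin [seq y <- firsts s | (predC1 x) y].
  by rewrite mem_filter /= eqxx.
rewrite congE //.
case: (boolP (x \in s)) => xs; last first.
  rewrite (count_memPn xs) /=; congr (flatten (map _ _)).
  apply/esym/all_filterP/allP => y; rewrite mem_firsts /=.
  by apply: contraTneq => ->.
case: s xs cvx {IHs cvxs congE xF} => // y s; rewrite inE => xs cvx.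
have exy : y = x.
  apply/eqP; apply: contraT => ne.
  have xs' : x \in s by move: xs; rewrite eq_sym (negPf ne).
  have := cvx x y; rewrite eq_sym ne => /(_ isT).
  by rewrite /= !eqxx sub1seq xs'.
rewrite exy /= eqxx; congr (_ ++ flatten (map _ _)).
rewrite filter_id //.
Qed.

Lemma cvx_cons (T : eqType) (a : T) (s : seq T) :
  (forall i j, i != j -> ~~ subseq [:: i; j; i] s) ->
  a \notin s \/ ohead s = Some a ->
  forall i j, i != j -> ~~ subseq [:: i; j; i] (a :: s).
Proof.
move=> cvx hs i j ne; rewrite [subseq _ _]/=.
case: eqP => [ia|_]; last exact: cvx.
move: ne; rewrite ia => ne; apply/negP => h; case: hs => [as_|].
  by move/negP: as_; apply; apply: (mem_subseq h); rewrite !inE eqxx orbT.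
case: s cvx h => // b s cvx h [eb]; rewrite {b}eb in cvx h.
by have := cvx a j ne; rewrite [subseq _ _]/= eqxx; move: h; rewrite /= eq_sym (negPf ne) => ->.
Qed.

Lemma blocks_spec (T : eqType) (c : T -> nat) (r : seq T) :
  uniq r -> {in r, forall a, (0 < c a)%N} ->
  let s := flatten [seq nseq (c a) a | a <- r] in
  firsts s = r /\ forall i j, i != j -> ~~ subseq [:: i; j; i] s.
Proof.
elim: r => [|a r IHr] /=; first by [].
move=> /andP[ar Ur] pos.
have [|] := IHr Ur; first by move=> b br; apply: pos; rewrite inE br orbT.
set s := flatten _ => Fs cvx.
have as_ : a \notin s by rewrite -mem_firsts Fs.
have: (0 < c a)%N by apply: pos; rewrite inE eqxx.
case: (c a) => // m _; elim: m => [|m [IH1 IH2]] /=.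
  split; last by apply: (@cvx_cons _ a s) => //; left.
  rewrite Fs; congr (_ :: _); apply/all_filterP/allP => b br /=.
  by apply: contraNneq ar => <-.
split; last by apply: (@cvx_cons _ a (nseq m.+1 a ++ s)) => //; right.
move: IH1 => /= -[IH1]; rewrite eqxx /= IH1; congr (_ :: _).
by apply/all_filterP/allP => b br /=; apply: contraNneq ar => <-.
Qed.

Lemma perm_conv_line n k (w : n.-tuple 'I_k) : perm_eq (conv_line w) w.
Proof.
apply: perm_trans (perm_count_undup w); apply: perm_flatten.
exact: perm_map (perm_initial_letters w).
Qed.

Lemma conv_line_size n k (w : n.-tuple 'I_k) : size (conv_line w) == n.
Proof. by rewrite (perm_size (perm_conv_line w)) size_tuple. Qed.

Lemma is_conv_line n k (w v : n.-tuple 'I_k) :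
  is_conv w v = (v == conv_line w :> seq 'I_k).
Proof.
apply/and3P/eqP => [[/forallP cvx pvw /eqP ini]|e].
  rewrite (@convex_firsts _ v); last first.
    by move=> i j ne; have /forallP/(_ j)/implyP := cvx i; apply.
  rewrite /conv_line -ini initial_lettersE; congr flatten.
  by apply: eq_map => a; move/seq.permP: pvw => ->.
have [|F cvx] := @blocks_spec _ (fun a => count_mem a w) _ (initial_letters_uniq w).
  by move=> a; rewrite mem_initial_letters -has_count has_pred1.
split.
- by apply/forallP => i; apply/forallP => j; apply/implyP; rewrite e; apply: cvx.
- by rewrite e perm_conv_line.
- by rewrite initial_lettersE e F.
Qed.

Lemma conv_exists n k (w : n.-tuple 'I_k) : exists v, is_conv w v.
Proof. by exists (Tuple (conv_line_size w)); rewrite is_conv_line. Qed.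

Definition conv n k (w : n.-tuple 'I_k) : n.-tuple 'I_k :=
  xchoose (conv_exists w).

Lemma convP n k (w : n.-tuple 'I_k) : is_conv w (conv w).
Proof. exact: xchooseP. Qed.

Lemma conv_unique n k (w v : n.-tuple 'I_k) : is_conv w v -> v = conv w.
Proof.
have := convP w; rewrite !is_conv_line => /eqP e /eqP e'.
by apply/val_inj; rewrite /= e' e.
Qed.

Definition sort_line n k (w : n.-tuple 'I_k) : seq nat :=
  flatten [seq [seq val j | j <- enum 'I_n & tnth w j == a]
          | a <- initial_letters w].

Lemma sort_line_perm n k (w : n.-tuple 'I_k) :
  perm_eq (sort_line w) (iota 0 n).
Proof.
rewrite -(val_enum_ord n) /sort_line (map_comp (map val)) -map_flatten.
apply: perm_map; apply: uniq_perm; [|exact: enum_uniq|].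
- elim: (initial_letters w) (initial_letters_uniq w) => //= a r IHr /andP[ar Ur].
  rewrite cat_uniq IHr // andbT (filter_uniq _ (enum_uniq _)) /=.
  apply/hasPn => j /flattenP[_ /mapP[b br ->]].
  rewrite !mem_filter => /andP[/eqP eb _]; rewrite eb.
  by apply: contra ar => /andP[/eqP <- _].
- move=> j; rewrite mem_enum; apply/flattenP.
  exists [seq i <- enum 'I_n | tnth w i == tnth w j].
    by apply/mapP; exists (tnth w j); rewrite // mem_initial_letters mem_tnth.
  by rewrite mem_filter eqxx mem_enum.
Qed.

Definition sort_perm n k (w : n.-tuple 'I_k) : 'S_n :=
  line_perm (sort_line_perm w).

Lemma msymXU N (s : 'S_N) (l : 'I_N) :
  msym s ('X_l : {mpoly int[N]}) = 'X_(s l).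
Proof. by rewrite /msym mmapX mmap1U. Qed.

Lemma divdiff_exists N (i j : 'I_N) (f : {mpoly int[N]}) :
  exists g : {mpoly int[N]}, g * ('X_i - 'X_j) == f - msym (tperm i j) f.
Proof.
set s := tperm i j.
pose P (f : {mpoly int[N]}) :=
  exists g : {mpoly int[N]}, g * ('X_i - 'X_j) == f - msym s f.
have P1 : P 1 by exists 0; rewrite mul0r msym1 subrr.
have PM p q : P p -> P q -> P (p * q).
  move=> [g /eqP eg] [h /eqP eh]; exists (g * q + msym s p * h).
  rewrite mulrDl mulrAC eg -mulrA eh msymM mulrBl mulrBr addrA.
  by rewrite subrK.
have PX l : P 'X_l.
  rewrite /P msymXU /s; case: tpermP => [->|->|_ _].
  - by exists 1; rewrite mul1r.
  - by exists (-1); rewrite mulN1r opprB.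
  - by exists 0; rewrite mul0r subrr.
have PXm m : P 'X_[m].
  rewrite mpolyXE_id; apply: (big_ind P) => // l _.
  by elim: (m l) => [|d IHd]; rewrite ?expr0 // exprS; apply: PM.
elim/mpolyind: f => [|c m p _ _ [g /eqP eg]].
  by exists 0; rewrite mul0r msym0 subrr.
have [h /eqP eh] := PXm m; exists (c *: h + g).
by rewrite mulrDl eg -scalerAl eh msymD msymZ scalerBr opprD addrACA.
Qed.

Definition divdiff N (i j : 'I_N) (f : {mpoly int[N]}) : {mpoly int[N]} :=
  xchoose (divdiff_exists i j f).

Lemma divdiffP N (i j : 'I_N) (f : {mpoly int[N]}) :
  divdiff i j f * ('X_i - 'X_j) = f - msym (tperm i j) f.
Proof. exact/eqP/(xchooseP (divdiff_exists i j f)). Qed.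

Lemma subX_neq0 N (i j : 'I_N) :
  i != j -> ('X_i - 'X_j : {mpoly int[N]}) != 0.
Proof.
move=> ne; rewrite subr_eq0; apply/eqP => /(congr1 (mcoeff U_(i))).
by rewrite !mcoeffXU eqxx eq_sym (negPf ne).
Qed.

Lemma divdiff_unique N (i j : 'I_N) (f g : {mpoly int[N]}) :
  i != j -> g * ('X_i - 'X_j) = f - msym (tperm i j) f -> g = divdiff i j f.
Proof.
by move=> ne; rewrite -divdiffP => /(mulIf (subX_neq0 ne)).
Qed.

Definition schubert_top N : {mpoly int[N]} := \prod_(i < N) 'X_i ^+ (N - i.+1).

(* [divdiff i j] is the operator $\partial_i$ when j = i + 1. In the library, *)
(* (s * t) x = t (s x), so [tperm i j * pi] is $\pi s_i$ in the functional    *)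
(* convention.                                                                *)
Definition ascent N (pi : 'S_N) (p : 'I_N * 'I_N) : bool :=
  (p.2 == p.1.+1 :> nat) && (pi p.1 < pi p.2)%N.

Definition noninversions N (pi : 'S_N) : {set 'I_N * 'I_N} :=
  [set p : 'I_N * 'I_N | (p.1 < p.2)%N && (pi p.1 < pi p.2)%N].

Fixpoint schubert_rec N (d : nat) (pi : 'S_N) : {mpoly int[N]} :=
  if d is d'.+1 then
    if [pick p | ascent pi p] is Some p then
      divdiff p.1 p.2 (schubert_rec d' (tperm p.1 p.2 * pi)%g)
    else schubert_top N
  else schubert_top N.

(* Climbs from pi to the longest permutation, whose noninversions form the    *)
(* empty set. The ascents picked on the way do not matter: see schubert_w0    *)
(* and schubert_divdiff.                                                      *)
Definition schubert N (pi : 'S_N) : {mpoly int[N]} :=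
  schubert_rec #|noninversions pi| pi.

Lemma schubert_w0 N :
  schubert (perm (@rev_ord_inj N)) = schubert_top N.
Proof.
rewrite /schubert (_ : noninversions _ = set0) ?cards0 //.
by apply/setP => -[i j]; rewrite !inE /= !permE /=; lia.
Qed.

Local Opaque divdiff.

Lemma comm_alg (R : comPzRingType) (x y f sf tf stf g sg h : R) :
  h * x = g - sg -> g * y = f - tf -> sg * y = sf - stf ->
  h * x * y = f - tf - sf + stf.
Proof. by move=> -> e1 e2; rewrite mulrBl e1 e2; ring. Qed.

Lemma braid_alg1 (R : comPzRingType) (x y z f sf tf tsf g tg h : R) :
  g * (x - y) = f - sf -> tg * (x - z) = tf - tsf -> h * (y - z) = g - tg ->
  h * ((x - y) * (x - z) * (y - z))
  = (f - sf) * (x - z) - (tf - tsf) * (x - y).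
Proof.
move=> <- <- e.
have -> : h * ((x - y) * (x - z) * (y - z)) = h * (y - z) * ((x - y) * (x - z)).
  by ring.
by rewrite e; ring.
Qed.

Lemma braid_alg2 (R : idomainType) (x y z f sf tf tsf stf stsf h sh k : R) :
  x - y != 0 ->
  h * ((x - y) * (x - z) * (y - z))
  = (f - sf) * (x - z) - (tf - tsf) * (x - y) ->
  sh * ((y - x) * (y - z) * (x - z))
  = (sf - f) * (y - z) - (stf - stsf) * (y - x) ->
  k * (x - y) = h - sh ->
  k * ((x - y) * (x - z) * (y - z)) = f - sf - tf + tsf + stf - stsf.
Proof.
move=> ne e1 e2 e3; apply: (mulIf ne).
have -> : k * ((x - y) * (x - z) * (y - z)) * (x - y)
    = k * (x - y) * ((x - y) * (x - z) * (y - z)) by ring.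
rewrite e3 mulrBl e1.
have -> : sh * ((x - y) * (x - z) * (y - z))
    = - (sh * ((y - x) * (y - z) * (x - z))) by ring.
by rewrite e2; ring.
Qed.

Lemma braid_alg3 (R : comPzRingType) (x y z p : R) :
  - p * ((x - y) * (x - z) * (y - z)) = p * ((z - y) * (z - x) * (y - x)).
Proof. by ring. Qed.

Lemma tperm_disjoint N (a b c d : 'I_N) :
  uniq [:: a; b; c; d] -> (tperm c d * tperm a b = tperm a b * tperm c d)%g.
Proof.
rewrite /= !inE !negb_or => /and4P[/and3P[ab ac ad] /andP[bc bd] cd _].
apply/permP => x; rewrite !permM.
have [da ca] : c != a /\ d != a by rewrite ![_ == a]eq_sym.
have [db cb] : c != b /\ d != b by rewrite ![_ == b]eq_sym.
case: (tpermP c d x) => [->|->|xc xd].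
- by rewrite !(tpermD (x := a)) // tpermL.
- by rewrite !(tpermD (x := a)) // tpermR.
- by case: tpermP => [_|_|/eqP xa /eqP xb]; rewrite tpermD // eq_sym; apply/eqP.
Qed.

Lemma tperm_braid N (a b c : 'I_N) : uniq [:: a; b; c] ->
  (tperm a b * tperm b c * tperm a b = tperm b c * tperm a b * tperm b c)%g.
Proof.
rewrite /= !inE !negb_or => /and3P[/andP[ab ac] bc _].
have [ba ca cb] : [/\ b != a, c != a & c != b].
  by split; rewrite eq_sym.
apply/permP => x; rewrite !permM.
case: (tpermP a b x) => [->|->|xa xb].
- by rewrite tpermL (tpermD (x := b) (y := c) (z := a)) // !tpermL tpermD.
- rewrite (tpermD (z := a)) // tpermL tpermL.
  by rewrite (tpermD (x := a) (y := b) (z := c)) ?tpermR.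
- case: (tpermP b c x) => [xb'|_|xb' xc]; first by case: xb.
    by rewrite !tpermR tpermD.
  by rewrite !tpermD // eq_sym; apply/eqP.
Qed.

Lemma divdiff_comm N (a b c d : 'I_N) (f : {mpoly int[N]}) :
  uniq [:: a; b; c; d] ->
  divdiff a b (divdiff c d f) = divdiff c d (divdiff a b f).
Proof.
have key (i j k l : 'I_N) : uniq [:: i; j; k; l] ->
    divdiff i j (divdiff k l f) * ('X_i - 'X_j) * ('X_k - 'X_l)
    = f - msym (tperm k l) f - msym (tperm i j) f
      + msym (tperm i j) (msym (tperm k l) f).
  rewrite /= !inE !negb_or => /and4P[/and3P[ij ik il] /andP[jk jl] kl _].
  have := congr1 (msym (tperm i j)) (divdiffP k l f).
  rewrite msymM !msymB !msymXU !tpermD // => e.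
  exact: comm_alg (divdiffP _ _ _) (divdiffP _ _ _) e.
move=> U; have U' : uniq [:: c; d; a; b].
  by move: U; rewrite -(uniq_catC [:: a; b] [:: c; d]).
have ne1 : a != b by move: U; rewrite /= !inE !negb_or => /andP[/andP[]].
have ne2 : c != d by move: U'; rewrite /= !inE !negb_or => /andP[/andP[]].
apply: (mulIf (subX_neq0 ne1)); apply: (mulIf (subX_neq0 ne2)).
apply: (etrans (key _ _ _ _ U)); apply: etrans (mulrAC _ _ _).
apply: (etrans _ (esym (key _ _ _ _ U'))).
rewrite -[in LHS]msymMm -[in RHS]msymMm.
rewrite (tperm_disjoint U).
congr (_ + _); exact: addrAC.
Qed.

Lemma divdiff_braid N (a b c : 'I_N) (f : {mpoly int[N]}) :
  uniq [:: a; b; c] ->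
  divdiff a b (divdiff b c (divdiff a b f))
  = divdiff b c (divdiff a b (divdiff b c f)).
Proof.
have symN (i j : 'I_N) g : i != j -> divdiff i j g = - divdiff j i g.
  move=> ne; apply/esym/divdiff_unique => //.
  by rewrite mulNr -mulrN opprB divdiffP tpermC.
have divN (i j : 'I_N) g : i != j -> divdiff i j (- g) = - divdiff i j g.
  move=> ne; apply/esym/divdiff_unique => //.
  by rewrite mulNr divdiffP msymN opprB opprK addrC.
pose s i j (g : {mpoly int[N]}) := msym (tperm i j) g.
have key (x y z : 'I_N) : uniq [:: x; y; z] ->
  divdiff x y (divdiff y z (divdiff x y f))
    * (('X_x - 'X_y) * ('X_x - 'X_z) * ('X_y - 'X_z))
  = f - s x y f - s y z f + s y z (s x y f) + s x y (s y z f)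
    - s x y (s y z (s x y f)).
  rewrite /= !inE negb_or => /and3P[/andP[xy xz] yz _].
  have zy : z != y by rewrite eq_sym.
  have zx : z != x by rewrite eq_sym.
  have yx : y != x by rewrite eq_sym.
  have ss g : s x y (s x y g) = g by rewrite /s -msymMm tperm2 msym1m.
  set g := divdiff x y f; set h := divdiff y z g.
  have e1 : s y z g * ('X_x - 'X_z) = s y z f - s y z (s x y f).
    have := congr1 (s y z) (divdiffP x y f).
    by rewrite /s msymM !msymB !msymXU tpermL tpermD.
  have e2 := braid_alg1 (divdiffP x y f) e1 (divdiffP y z g).
  apply: (braid_alg2 (subX_neq0 xy) e2 _ (divdiffP x y h)).
  have := congr1 (s x y) e2.
  have sM p q : s x y (p * q) = s x y p * s x y q by exact: msymM.
  have sB p q : s x y (p - q) = s x y p - s x y q by exact: msymB.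
  have sx : s x y 'X_x = 'X_y by rewrite /s msymXU tpermL.
  have sy : s x y 'X_y = 'X_x by rewrite /s msymXU tpermR.
  have sz : s x y 'X_z = 'X_z by rewrite /s msymXU tpermD.
  by rewrite !(sM, sB) sx sy sz ss.
move=> U; have U' : uniq [:: c; b; a] by rewrite -(rev_uniq [:: a; b; c]) in U.
move: (U) (U'); rewrite /= !inE !negb_or.
move=> /and3P[/andP[ab ac] bc _] /and3P[/andP[cb ca] ba _].
have D0 : (('X_a - 'X_b) * ('X_a - 'X_c) * ('X_b - 'X_c) : {mpoly int[N]}) != 0.
  by rewrite !mulf_neq0 ?subX_neq0.
have E : divdiff b c (divdiff a b (divdiff b c f))
    = - divdiff c b (divdiff b a (divdiff c b f)).
  rewrite (symN b c f bc) (divN a b _ ab) (symN a b _ ab) opprK.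
  exact: symN.
apply: (mulIf D0); apply: (etrans (key _ _ _ U)); rewrite E.
apply: etrans (esym (braid_alg3 _ _ _ _)).
apply: (etrans _ (esym (key _ _ _ U'))).
rewrite /s !(tpermC c b) !(tpermC b a).
have -> : msym (tperm a b) (msym (tperm b c) (msym (tperm a b) f))
    = msym (tperm b c) (msym (tperm a b) (msym (tperm b c) f)).
  by rewrite -!msymMm mulgA tperm_braid // mulgA.
congr (_ - _); rewrite -!(addrA (f - _ - _)); congr (_ + _); first exact: addrAC.
exact: addrC.
Qed.

Lemma noninversions_tperm N (pi : 'S_N) (i j : 'I_N) :
  ascent pi (i, j) ->
  #|noninversions pi| = #|noninversions (tperm i j * pi)%g|.+1.
Proof.
move=> /andP[/= /eqP ji lt].
rewrite (cardsD1 (i, j)) inE /= lt ji ltnSn add1n; congr _.+1.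
pose F (p : 'I_N * 'I_N) := (tperm i j p.1, tperm i j p.2).
have FK : involutive F by case=> a b; rewrite /F /= !tpermK.
have mono (a b : 'I_N) : (a < b)%N -> (a, b) != (i, j) ->
    (tperm i j a < tperm i j b)%N /\ (tperm i j a, tperm i j b) != (i, j).
  rewrite !xpair_eqE => lab ne.
  have ne' : ~~ ((nat_of_ord a == i) && (nat_of_ord b == j)) by exact: ne.
  suff [h1 h2] : (tperm i j a < tperm i j b)%N /\
      ~~ ((nat_of_ord (tperm i j a) == i) && (nat_of_ord (tperm i j b) == j)).
    by split.
  have v (x : 'I_N) : nat_of_ord (tperm i j x)
      = if x == i :> nat then j : nat else if x == j :> nat then i : nat
        else x : nat.
    rewrite !val_eqE; case: tpermP => [->|->|/eqP/negPf-> /eqP/negPf->] //.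
      by rewrite eqxx.
    by rewrite eqxx; case: eqP => // ->.
  move: lab ne' ji; rewrite !v; move: (nat_of_ord a) (nat_of_ord b).
  move: (nat_of_ord i) (nat_of_ord j) => x y p q.
  by do !case: ifP; lia.
rewrite -(card_imset _ (inv_inj FK)); apply: eq_card => -[a b].
apply/imsetP/idP => [[[c d]]|].
  rewrite !inE /= => /and3P[ne lcd lp] [-> ->]; rewrite !permM !tpermK lp andbT.
  by case: (mono _ _ lcd ne).
rewrite !inE /= !permM => /andP[lab lp]; exists (F (a, b)); last by rewrite FK.
have ne : (a, b) != (i, j).
  apply: contraTneq lp => -[-> ->]; rewrite tpermL tpermR -leqNgt; exact: ltnW.
by rewrite !inE /= lp andbT; case: (mono _ _ lab ne) => -> ->.
Qed.

Lemma ascent_exists N (pi : 'S_N) :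
  (0 < #|noninversions pi|)%N -> exists p, ascent pi p.
Proof.
case/card_gt0P => -[a b]; rewrite inE /= => /andP[].
move em : (b - a)%N => m; elim: m b em => [|m IHm] b em lab lp; first by lia.
have [eq|ne] := eqVneq (nat_of_ord b) a.+1.
  by exists (a, b); rewrite /ascent /= eq eqxx.
have lb : (b.-1 < N)%N by have := ltn_ord b; lia.
pose b' := Ordinal lb.
have [lp'|ge] := ltnP (pi a) (pi b'); first by apply: (IHm b') => //=; move: ne; lia.
exists (b', b); rewrite /ascent /= (leq_ltn_trans ge lp) andbT.
by move: lab; lia.
Qed.

Lemma schubert_rec_ascent N d (pi : 'S_N) (i j : 'I_N) :
  #|noninversions pi| = d.+1 -> ascent pi (i, j) ->
  schubert_rec d.+1 pi = divdiff i j (schubert_rec d (tperm i j * pi)%g).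
Proof.
elim/ltn_ind: d pi i j => d IHd pi i j card_pi asc.
rewrite [LHS]/=; case: pickP => [[a b] asc'|none]; last by rewrite none in asc.
have lower (r : 'S_N) x y e : #|noninversions r| = e.+1 -> ascent r (x, y) ->
    #|noninversions (tperm x y * r)%g| = e.
  by move=> h /noninversions_tperm; rewrite h => -[].
have braid (a1 b1 c1 : 'I_N) : ascent pi (a1, b1) -> ascent pi (b1, c1) ->
    divdiff a1 b1 (schubert_rec d (tperm a1 b1 * pi)%g)
    = divdiff b1 c1 (schubert_rec d (tperm b1 c1 * pi)%g).
  move=> asc1 asc2; have /andP[/= /eqP ba lab] := asc1.
  have /andP[/= /eqP cb lbc] := asc2.
  have ab : a1 != b1 by rewrite -val_eqE /=; lia.
  have ac : a1 != c1 by rewrite -val_eqE /=; lia.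
  have bc : b1 != c1 by rewrite -val_eqE /=; lia.
  have [ba' ca cb'] : [/\ b1 != a1, c1 != a1 & c1 != b1].
    by rewrite (eq_sym b1) (eq_sym c1) (eq_sym c1) ab ac bc.
  have lac := ltn_trans lab lbc.
  have d1 := lower _ _ _ _ card_pi asc1; have d2 := lower _ _ _ _ card_pi asc2.
  have asc12 : ascent (tperm a1 b1 * pi)%g (b1, c1).
    by rewrite /ascent /= !permM tpermR (tpermD ac bc) cb eqxx.
  have asc21 : ascent (tperm b1 c1 * pi)%g (a1, b1).
    by rewrite /ascent /= !permM tpermL (tpermD ba' ca) ba eqxx.
  case: d IHd card_pi d1 d2 => [|d] IHd card_pi d1 d2.
    by exfalso; have := noninversions_tperm asc12; rewrite d1.
  have e1 := lower _ _ _ _ d1 asc12; have e2 := lower _ _ _ _ d2 asc21.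
  have asc121 : ascent (tperm b1 c1 * (tperm a1 b1 * pi))%g (a1, b1).
    by rewrite /ascent /= !permM !tpermL (tpermD ba' ca) tpermL (tpermD ac bc) ba eqxx.
  have asc212 : ascent (tperm a1 b1 * (tperm b1 c1 * pi))%g (b1, c1).
    rewrite /ascent /= !permM tpermR (tpermD ba' ca) (tpermD (x := a1) (y := b1) ac bc).
    by rewrite tpermR cb eqxx.
  rewrite (IHd d (ltnSn _) _ _ _ d1 asc12) (IHd d (ltnSn _) _ _ _ d2 asc21).
  case: d IHd card_pi d1 d2 e1 e2 => [|d] IHd card_pi d1 d2 e1 e2.
    by exfalso; have := noninversions_tperm asc121; rewrite e1.
  have ltd : (d < d.+2)%N by exact: ltnW (ltnSn _).
  rewrite (IHd d ltd _ _ _ e1 asc121) (IHd d ltd _ _ _ e2 asc212).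
  rewrite divdiff_braid ?mulgA; last by rewrite /= !inE negb_or ab ac bc.
  by rewrite tperm_braid //= !inE negb_or ab ac bc.
have /andP[/= /eqP ba lab] := asc'; have /andP[/= /eqP ji lij] := asc.
have [eai|nai] := eqVneq a i.
  have ebj : b = j by apply/val_inj; rewrite /= ba ji eai.
  by rewrite eai ebj.
have [ebi|nbi] := eqVneq b i.
  by rewrite ebi in asc' *; apply: braid.
have [eja|nja] := eqVneq j a.
  by rewrite eja in asc *; apply/esym/braid.
rewrite -!val_eqE /= in nai nbi nja.
have ai : a != i by rewrite -val_eqE.
have aj : a != j by rewrite -val_eqE /= eq_sym.
have bi : b != i by rewrite -val_eqE.
have bj : b != j by rewrite -val_eqE /=; lia.
have ab : a != b by rewrite -val_eqE /=; lia.
have ij : i != j by rewrite -val_eqE /=; lia.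
have d1 := lower _ _ _ _ card_pi asc'; have d2 := lower _ _ _ _ card_pi asc.
have asc1 : ascent (tperm a b * pi)%g (i, j).
  by rewrite /ascent /= !permM !tpermD // ji eqxx.
have asc2 : ascent (tperm i j * pi)%g (a, b).
  by rewrite /ascent /= !permM !tpermD 1?eq_sym // ba eqxx.
case: d IHd card_pi d1 d2 {braid} => [|d] IHd card_pi d1 d2.
  by exfalso; have := noninversions_tperm asc1; rewrite d1.
rewrite (IHd d (ltnSn _) _ _ _ d1 asc1) (IHd d (ltnSn _) _ _ _ d2 asc2).
rewrite divdiff_comm; last by rewrite /= !inE !negb_or ab ai aj bi bj ij.
rewrite !mulgA tperm_disjoint //.
by rewrite /= !inE !negb_or ab ai aj bi bj ij.
Qed.

Lemma schubert_divdiff N (pi : 'S_N) (i j : 'I_N) :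
  j = i.+1 :> nat -> (pi j < pi i)%N ->
  schubert (tperm i j * pi)%g = divdiff i j (schubert pi).
Proof.
move=> ji lt.
have asc : ascent (tperm i j * pi)%g (i, j).
  by rewrite /ascent /= !permM tpermL tpermR ji eqxx.
have e : #|noninversions (tperm i j * pi)%g| = #|noninversions pi|.+1.
  by rewrite (noninversions_tperm asc) mulgA tperm2 mul1g.
by rewrite /schubert e (schubert_rec_ascent e asc) mulgA tperm2 mul1g.
Qed.

(* Keeps the first n variables and sets the other ones, if any, to 0.         *)
Definition trunc_vars N n (f : {mpoly int[N]}) : {mpoly int[n]} :=
  f \mPo [tuple if insub (val i) is Some j then 'X_j else 0 | i < N].

(* The one-line notation of std (conv w) increases from position n on, so its *)
(* Schubert polynomial only involves the first n variables and trunc_vars     *)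
(* merely retypes it. [msym s] maps 'X_i to 'X_(s i).                         *)
Definition schubert_word n k (w : n.-tuple 'I_k) : {mpoly int[n]} :=
  msym (sort_perm w)^-1%g (trunc_vars n (schubert (std (conv w)))).

Definition rev_vars n (f : {mpoly int[n]}) : {mpoly int[n]} :=
  f \mPo [tuple 'X_(rev_ord i) | i < n].

(* Main.v *)
From HB Require Import structures.
Require Import Defs.
From mathcomp Require Import all_boot all_order all_fingroup all_algebra.
From mathcomp Require Import zify.

Set Implicit Arguments.
Unset Strict Implicit.
Unset Printing Implicit Defensive.

Import GRing.Theory.
Local Open Scope ring_scope.

(** Prepending the letter 1 turns [std (conv w)] and [sort_perm w] into their
    lifts fixing the first position, so the claim reduces to
    $S_{1 \times \pi}(0, x_1, \dots, x_n) = S_\pi(x_1, \dots, x_n)$. Killing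
    $x_1$ commutes with $\partial_2, \partial_3, \dots$, which reduces it
    further to the longest permutation $\pi = w_0$. There one starts from the
    longest permutation of $S_{n+1}$ and moves its smallest value from the last
    position to the first one: whenever that value sits in position $p$, the
    Schubert polynomial is divisible by $x_i$ for $i < p$, and it becomes an
    explicit monomial when $x_p = 0$. *)

(** * Setting one variable to zero *)

(** Ring morphisms all agree on the integer coefficients, so identities between substitutions need
    checking only on variables. *)
Lemma rmorph_mpoly_ext n (R : comNzRingType)
    (f g : {rmorphism {mpoly int[n]} -> R}) :
  (forall i, f 'X_i = g 'X_i) -> f =1 g.
Proof.
move=> fg; elim/mpolyind => [|c m p _ _ IHp]; first by rewrite !rmorph0.
rewrite !rmorphD IHp; congr (_ + _).
rewrite -[c]intz scaler_int !rmorphMz; congr (_ *~ _).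
rewrite mpolyXE_id !rmorph_prod; apply: eq_bigr => i _.
by rewrite !rmorphXn fg.
Qed.

(** The index is arbitrary because the induction kills the variable at each position that the
    smallest value visits. *)
Definition kill_var n (p : 'I_n.+1) : {mpoly int[n.+1]} -> {mpoly int[n]} :=
  comp_mpoly [tuple oapp (fun i => 'X_i) 0 (unlift p j) | j < n.+1].

HB.instance Definition _ n (p : 'I_n.+1) :=
  GRing.RMorphism.on (kill_var p).

Lemma kill_var_id n (p : 'I_n.+1) : kill_var p 'X_p = 0.
Proof. by rewrite /kill_var comp_mpolyXU -tnth_nth tnth_mktuple unlift_none. Qed.

Lemma kill_var_lift n (p : 'I_n.+1) i : kill_var p 'X_(lift p i) = 'X_i.
Proof. by rewrite /kill_var comp_mpolyXU -tnth_nth tnth_mktuple liftK. Qed.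

Lemma tperm_lift_same n (q p : 'I_n.+1) (i : 'I_n) :
  p = q.+1 :> nat -> tperm q p (lift q i) = lift p i.
Proof.
move=> pq; apply: val_inj => /=.
case: tpermP => [/(congr1 val)|/(congr1 val)|/eqP _ /eqP] /=;
  rewrite -?val_eqE /= /bump; lia.
Qed.

(** Turns the exchanged term of a divided difference into [kill_var p f], which the induction
    controls. *)
Lemma kill_var_tperm n (q p : 'I_n.+1) f :
  p = q.+1 :> nat -> kill_var q (msym (tperm q p) f) = kill_var p f.
Proof.
move=> pq; move: f.
apply: (rmorph_mpoly_ext (f := kill_var q \o msym (tperm q p))) => /= i.
rewrite msymXU; case: (unliftP p i) => [j|] ->.
  by rewrite -(tperm_lift_same _ pq) tpermK !kill_var_lift tperm_lift_same ?kill_var_lift.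
by rewrite tpermR !kill_var_id.
Qed.

Lemma divdiff_mulXl N (i j l : 'I_N) (f : {mpoly int[N]}) :
  uniq [:: i; j; l] -> divdiff i j ('X_l * f) = 'X_l * divdiff i j f.
Proof.
rewrite /= !inE !negb_or => /and3P[/andP[ij il] jl _].
apply/esym/divdiff_unique => //.
by rewrite -mulrA divdiffP msymM msymXU tpermD // mulrBr.
Qed.

(** Killing ['X_p] carries the defining equation of one divided difference to that of the other,
    whose solution is unique. *)
Lemma kill_var_divdiff n (p : 'I_n.+1) (i j : 'I_n) f :
  i != j ->
  kill_var p (divdiff (lift p i) (lift p j) f) = divdiff i j (kill_var p f).
Proof.
move=> ij; apply: divdiff_unique => //.
rewrite -[in LHS](kill_var_lift p i) -[in LHS](kill_var_lift p j).
rewrite -rmorphB -rmorphM divdiffP rmorphB; congr (_ - _).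
move: f; apply: (rmorph_mpoly_ext (f := kill_var p \o msym _)
  (g := msym (tperm i j) \o kill_var p)) => /= l.
rewrite msymXU; case: (unliftP p l) => [m|] ->; last first.
  by rewrite tpermD ?[lift _ _ == _]eq_sym ?neq_lift // kill_var_id msym0.
by rewrite kill_var_lift msymXU -inj_tperm ?kill_var_lift //; apply: lift_inj.
Qed.

(** * Moving the smallest value through the longest permutation *)

Lemma tperm_lift_perm n (q p r : 'I_n.+1) (pi : 'S_n) :
  p = q.+1 :> nat -> (tperm q p * lift_perm p r pi = lift_perm q r pi)%g.
Proof.
move=> pq; apply/permP => x; rewrite permM.
case: (unliftP q x) => [y|] ->; last by rewrite tpermL !lift_perm_id.
by rewrite tperm_lift_same // !lift_perm_lift.
Qed.

Lemma noninversions_lift_perm_max n (pi : 'S_n) :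
  noninversions pi = set0 ->
  noninversions (lift_perm ord_max ord0 pi) = set0.
Proof.
move/setP => pi0; apply/setP => -[i j]; rewrite !inE /=; apply/negP => /andP[ij].
case: (unliftP ord_max i) ij => [i'|] ->; last by move: (ltn_ord j); rewrite /=; lia.
case: (unliftP ord_max j) => [j'|] -> ij; last by rewrite lift_perm_id ltn0.
rewrite !lift_perm_lift /= /bump !leq0n !add1n ltnS => lt.
have := pi0 (i', j'); rewrite !inE /= lt andbT => /negP; apply.
by move: ij; rewrite /= /bump; move: (ltn_ord i') (ltn_ord j'); lia.
Qed.

Lemma schubert_noninversions0 N (pi : 'S_N) :
  noninversions pi = set0 -> schubert pi = schubert_top N.
Proof. by rewrite /schubert => ->; rewrite cards0. Qed.

(* Divisibility by the variables left of [p] is what makes the term           *)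
(* [kill_var q F] of the divided difference vanish when [p] moves to [q].     *)
Lemma kill_var_schubert_lift_top n (pi : 'S_n) (p : 'I_n.+1) :
  noninversions pi = set0 ->
  (forall i : 'I_n.+1, (i < p)%N ->
     exists h, schubert (lift_perm p ord0 pi) = 'X_i * h) /\
  kill_var p (schubert (lift_perm p ord0 pi))
  = \prod_(i < n) 'X_i ^+ (n - i.+1 + (i < p)).
Proof.
(* Induction on the distance from [p] to the last position, where the lifted permutation is the
   longest one. *)
move=> pi0; move ed : (n - p)%N => d.
elim: d p ed => [|d IHd] p ed.
  have -> : p = ord_max by apply: val_inj => /=; move: (ltn_ord p); lia.
  rewrite schubert_noninversions0 ?noninversions_lift_perm_max // /schubert_top.
  split=> [i lt|].
    rewrite (bigD1 i) //=.
    have -> : (n.+1 - i.+1)%N = (n - i.+1).+1 by move: lt => /=; lia.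
    by rewrite exprS -mulrA; eexists.
  (* The last variable has exponent 0 in the staircase monomial, so killing it loses nothing. *)
  rewrite big_ord_recr /= subnn expr0 mulr1 rmorph_prod.
  apply: eq_bigr => i _; rewrite rmorphXn.
  have -> : widen_ord (leqnSn n) i = lift ord_max i.
    by apply: val_inj; rewrite /= /bump leqNgt ltn_ord.
  rewrite /= kill_var_lift ltn_ord; congr (_ ^+ _).
  by move: (ltn_ord i); lia.
have lt_p : (p.+1 < n.+1)%N by lia.
pose r := Ordinal lt_p; pose q := Ordinal (ltn_trans (ltnSn p) lt_p).
have -> : p = q by apply: val_inj.
have rq : r = q.+1 :> nat by [].
have nqr : q != r by rewrite -val_eqE /=; lia.
have [|dvd top] := IHd r; first by rewrite /=; lia.
have ->: schubert (lift_perm q ord0 pi)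
    = divdiff q r (schubert (lift_perm r ord0 pi)).
  (* Position [r] holds the smallest value, so [q] and [r] form a descent. *)
  rewrite -(tperm_lift_perm _ _ rq) schubert_divdiff // lift_perm_id.
  have := perm_inj (s := lift_perm r ord0 pi) (x1 := q) (x2 := r).
  rewrite lift_perm_id lt0n => inj; apply: contraNneq nqr => e.
  by apply/eqP/inj/val_inj.
set F := schubert _ in dvd top *; split=> [i lt|].
  have [|h ->] := dvd i; first by rewrite rq ltnW.
  exists (divdiff q r h); rewrite divdiff_mulXl //= !inE negb_or nqr.
  by rewrite -!val_eqE /=; move: lt => /=; lia.
(* Once ['X_q] is killed, ['X_r] is renamed ['X_q']. *)
pose q' : 'I_n := Ordinal (lt_p : (p < n)%N).
have er : r = lift q q' by apply: val_inj; rewrite /= /bump leqnn.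
have := congr1 (kill_var q) (divdiffP q r F).
rewrite rmorphM !rmorphB /= kill_var_tperm //.
have [|h eF] := dvd q; first by rewrite rq.
rewrite {2}eF rmorphM /= kill_var_id mul0r {2}er kill_var_lift !sub0r mulrN.
(* Cancelling one factor ['X_q'] removes the extra 1 in its exponent; for the other indices [i < r]
   and [i < q] agree. *)
move/oppr_inj; rewrite top (bigD1 q') //= ltnSn addn1 exprSr.
rewrite mulrAC => /mulIf ->; last by rewrite -msupp_eq0 msuppX.
rewrite [RHS](bigD1 q') //= ltnn addn0; congr (_ * _).
apply: eq_bigr => i ne; congr (_ ^+ (_ + _)).
by move: ne; rewrite -val_eqE /=; lia.
Qed.

Lemma kill_var_schubert_lift n (pi : 'S_n) :
  kill_var ord0 (schubert (lift_perm ord0 ord0 pi)) = schubert pi.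
Proof.
move ed : #|noninversions pi| => d; elim: d pi ed => [|d IHd] pi ed.
  have pi0 : noninversions pi = set0 by apply/eqP; rewrite -cards_eq0 ed.
  (* Nothing lies left of position 0, so the monomial is the plain staircase. *)
  have [_ ->] := kill_var_schubert_lift_top ord0 pi0.
  rewrite (schubert_noninversions0 pi0); apply: eq_bigr => i _.
  by rewrite addn0.
have [|[i j] asc] := @ascent_exists _ pi; first by rewrite ed.
have /andP[/= /eqP ji lt] := asc.
pose rho := (tperm i j * pi)%g.
have epi : pi = (tperm i j * rho)%g by rewrite mulgA tperm2 mul1g.
have lt_rho : (rho j < rho i)%N by rewrite !permM tpermL tpermR.
have ij : i != j by rewrite -val_eqE /=; lia.
have Irho : kill_var ord0 (schubert (lift_perm ord0 ord0 rho)) = schubert rho.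
  by apply: IHd; have := noninversions_tperm asc; rewrite ed => -[].
rewrite epi schubert_divdiff // -Irho -kill_var_divdiff //; congr kill_var.
rewrite -schubert_divdiff.
- congr schubert; apply/permP => x; rewrite permM.
  case: (unliftP ord0 x) => [y|] ->; last first.
    by rewrite tpermD ?[lift _ _ == _]eq_sym ?neq_lift // !lift_perm_id.
  rewrite -inj_tperm; last exact: lift_inj.
  by rewrite !lift_perm_lift permM.
- by rewrite /= /bump ji.
- by rewrite !lift_perm_lift /= /bump !add1n ltnS.
Qed.

(** * Words with a new smallest letter in front *)

Lemma firsts_map (T U : eqType) (f : T -> U) (s : seq T) :
  injective f -> firsts (map f s) = map f (firsts s).
Proof.
move=> inj_f; elim: s => //= x s ->; congr (_ :: _).
rewrite filter_map; congr map; apply: eq_filter => y /=.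
by rewrite (inj_eq inj_f).
Qed.

Lemma ord0_notin_map_lift k (s : seq 'I_k) : ord0 \notin map (lift ord0) s.
Proof. by apply/mapP => -[a _] /eqP; apply/negP; rewrite neq_lift. Qed.

Lemma initial_letters_one_times n k (w : n.-tuple 'I_k) :
  initial_letters (one_times w)
  = ord0 :: map (lift ord0) (initial_letters w).
Proof.
rewrite !initial_lettersE /= firsts_map; last exact: lift_inj.
congr (_ :: _); apply/all_filterP/allP => a a_w /=.
by apply: contraTneq a_w => ->; apply: ord0_notin_map_lift.
Qed.

Lemma count_mem_one_times n k (w : n.-tuple 'I_k) a :
  count_mem (lift ord0 a) (one_times w) = count_mem a w.
Proof.
rewrite /= add0n count_map; apply: eq_count => b /=.
by rewrite (inj_eq lift_inj).
Qed.

(** By uniqueness of [conv]: the new letter is a block of length one in front, and the shift keeps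
    all other multiplicities. *)
Lemma conv_one_times n k (w : n.-tuple 'I_k) :
  conv (one_times w) = one_times (conv w).
Proof.
apply/esym/conv_unique; rewrite is_conv_line; apply/eqP.
rewrite /conv_line initial_letters_one_times map_cons -map_comp.
have := convP w; rewrite is_conv_line => /eqP /= ->.
rewrite (count_memPn (ord0_notin_map_lift w)) /=; congr (_ :: _).
rewrite /conv_line map_flatten -map_comp; congr flatten.
by apply: eq_map => a /=; rewrite map_nseq -count_mem_one_times.
Qed.

Lemma initial_one_times0 n k (w : n.-tuple 'I_k) : initial (one_times w) ord0.
Proof. by apply/forallP => i; apply/implyP. Qed.

Lemma tnth_one_times0 n k (w : n.-tuple 'I_k) :
  tnth (one_times w) ord0 = ord0.
Proof. by []. Qed.

Lemma tnth_one_times n k (w : n.-tuple 'I_k) j :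
  tnth (one_times w) (lift ord0 j) = lift ord0 (tnth w j).
Proof. by rewrite tnthS tnth_map. Qed.

Lemma initial_one_times n k (w : n.-tuple 'I_k) j :
  initial (one_times w) (lift ord0 j) = initial w j.
Proof.
apply/forallP/forallP => h i.
  have := h (lift ord0 i); rewrite !tnth_one_times (inj_eq lift_inj).
  by rewrite /= /bump !add1n ltnS.
rewrite tnth_one_times; case: (unliftP ord0 i) => [i'|] ->.
  have := h i'; rewrite tnth_one_times (inj_eq lift_inj).
  by rewrite /= /bump !add1n ltnS.
by rewrite tnth_one_times0 neq_lift implybT.
Qed.

(** The new position is initial, so ranks of noninitial positions are unchanged while their offset
    [k] grows by one. *)
Lemma std_line_one_times n k (w : n.-tuple 'I_k) :
  std_line (one_times w) = 0%N :: map succn (std_line w).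
Proof.
rewrite /std_line enum_ordSl /= initial_one_times0; congr (_ :: _).
rewrite map_cat -!map_comp; congr (_ ++ _).
  apply: eq_map => j /=; rewrite initial_one_times tnth_one_times.
  case: ifP => // _; rewrite addSn; congr (_ + _).+1.
  rewrite -(card_imset _ (@lift_inj n.+1 ord0)); apply: eq_card => i.
  rewrite !inE; case: (unliftP ord0 i) => [i'|] ->.
    rewrite (mem_imset _ _ lift_inj) !inE initial_one_times.
    by rewrite /= /bump !add1n ltnS.
  rewrite initial_one_times0 andbF; apply/esym/imsetP => -[a _] /eqP.
  by apply/negP; rewrite neq_lift.
rewrite enum_ordSl /= filter_map -map_comp.
rewrite (eq_map (g := succn \o val)); last by move=> a.
congr map; apply: eq_filter => a /=.
by rewrite inE eq_sym (negPf (neq_lift _ _)) mem_map //; apply: lift_inj.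
Qed.

Lemma sort_line_one_times n k (w : n.-tuple 'I_k) :
  sort_line (one_times w) = 0%N :: map succn (sort_line w).
Proof.
have eq0 a : (lift ord0 a == ord0 :> 'I_k.+1) = false.
  by rewrite eq_sym (negPf (neq_lift _ _)).
rewrite /sort_line initial_letters_one_times /= enum_ordSl /=.
rewrite filter_map (eq_filter (a2 := pred0)) ?filter_pred0 /=; last first.
  by move=> j /=; rewrite tnth_one_times eq0.
congr (_ :: _); rewrite map_flatten -[in LHS]map_comp -[in RHS]map_comp.
congr flatten; apply: eq_map => a /=.
rewrite filter_map -[in LHS]map_comp -[in RHS]map_comp (eq_map (g := succn \o val)); last by move=> j.
congr map; apply: eq_filter => j /=.
by rewrite tnth_one_times (inj_eq lift_inj).
Qed.

(** * One-line notations and changes of variables *)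

Lemma line_perm_cons0 n (s : seq nat) (hs : perm_eq s (iota 0 n))
    (hs' : perm_eq (0%N :: map succn s) (iota 0 n.+1)) :
  line_perm hs' = lift_perm ord0 ord0 (line_perm hs).
Proof.
apply/permP => i; apply: val_inj; rewrite /= line_permE.
case: (unliftP ord0 i) => [j|] ->; last by rewrite lift_perm_id.
rewrite lift_perm_lift /= (nth_map 0%N) ?line_permE //.
by rewrite (perm_size hs) size_iota; apply: (ltn_ord j).
Qed.

Lemma line_perm_eq n (s t : seq nat) (hs : perm_eq s (iota 0 n))
    (ht : perm_eq t (iota 0 n)) :
  s = t -> line_perm hs = line_perm ht.
Proof. by move=> e; apply/permP => i; apply: val_inj; rewrite /= !line_permE e. Qed.

Lemma sort_perm_one_times n k (w : n.-tuple 'I_k) :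
  sort_perm (one_times w) = lift_perm ord0 ord0 (sort_perm w).
Proof.
have hs : perm_eq (0%N :: map succn (sort_line w)) (iota 0 n.+1).
  by rewrite -sort_line_one_times sort_line_perm.
rewrite -(line_perm_cons0 (sort_line_perm w) hs); apply: line_perm_eq.
exact: sort_line_one_times.
Qed.

Lemma trunc_varsX N n (i : 'I_N) :
  trunc_vars n 'X_i = if insub (val i) is Some j then 'X_j else 0.
Proof. by rewrite /trunc_vars comp_mpolyXU -tnth_nth tnth_mktuple. Qed.

Lemma rev_varsX n (i : 'I_n) : rev_vars 'X_i = 'X_(rev_ord i).
Proof. by rewrite /rev_vars comp_mpolyXU -tnth_nth tnth_mktuple. Qed.

(** The size of [std (conv w)] equals [n] only propositionally; this removes the cast. *)
Lemma trunc_vars_schubert N n (s : seq nat) (hN : perm_eq s (iota 0 N))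
    (hn : perm_eq s (iota 0 n)) :
  trunc_vars n (schubert (line_perm hN)) = schubert (line_perm hn).
Proof.
have eN : N = n.
  by rewrite -(size_iota 0 N) -(perm_size hN) (perm_size hn) size_iota.
case: _ / eN hn => hn; rewrite (line_perm_eq hn hN) //.
have fixX i : trunc_vars N 'X_i = 'X_i by rewrite trunc_varsX valK.
move: (schubert _).
exact: (rmorph_mpoly_ext (f := comp_mpoly _) (g := idfun)) fixX.
Qed.

(** All [k] letters survive the rearrangement, so no missing letter is appended. *)
Lemma std_line_conv_perm n k (w : n.-tuple 'I_k) :
  w \in surj_words n k -> perm_eq (std_line (conv w)) (iota 0 n).
Proof.
rewrite inE => /forallP hw; have := std_line_perm (conv w).
suff -> : distinct_letters (conv w) = k by rewrite addnK.
have /and3P[_ pw _] := convP w.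
rewrite /distinct_letters -(card_uniqP (undup_uniq _)) -[RHS]card_ord.
by apply: eq_card => a; rewrite mem_undup (perm_mem pw) hw.
Qed.

(** Reversal sends the first variable, fixed by the lifted permutation, to the last one, which
    truncation kills. *)
Lemma trunc_rev_msym_lift n (s : 'S_n) f :
  trunc_vars n (rev_vars (msym (lift_perm ord0 ord0 s) f))
  = rev_vars (msym s (kill_var ord0 f)).
Proof.
have onX i : trunc_vars n (rev_vars (msym (lift_perm ord0 ord0 s) 'X_i))
    = rev_vars (msym s (kill_var ord0 'X_i)).
  rewrite msymXU rev_varsX trunc_varsX; case: (unliftP ord0 i) => [j|] ->.
    rewrite kill_var_lift lift_perm_lift msymXU rev_varsX.
    (* Reversed indices count from the end, so an extra position in front does not change them. *)
    have -> : val (rev_ord (lift ord0 (s j))) = val (rev_ord (s j)) by [].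
    by rewrite valK.
  rewrite kill_var_id lift_perm_id msym0 /rev_vars comp_mpoly0 insubN //=.
  by rewrite subn1 ltnn.
move: f; exact: (rmorph_mpoly_ext
  (f := comp_mpoly _ \o (comp_mpoly _ \o msym _))
  (g := comp_mpoly _ \o (msym s \o kill_var ord0))) onX.
Qed.

Theorem theorem7p4 (n k : nat) (hk : (0 < k)%N) (hkn : (k <= n)%N)
    (w : n.-tuple 'I_k) (hw : w \in surj_words n k) :
  trunc_vars n (rev_vars (schubert_word (one_times w)))
  = rev_vars (schubert_word w).
Proof.
have h := std_line_conv_perm hw.
have h1 := std_line_conv_perm (one_times_surj hw).
have hs : perm_eq (0%N :: map succn (std_line (conv w))) (iota 0 n.+1).
  by rewrite -std_line_one_times -conv_one_times.
rewrite /schubert_word /std (trunc_vars_schubert _ h) (trunc_vars_schubert _ h1).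
have -> : line_perm h1 = lift_perm ord0 ord0 (line_perm h).
  rewrite -(line_perm_cons0 h hs); apply: line_perm_eq.
  by rewrite conv_one_times std_line_one_times.
rewrite sort_perm_one_times lift_permV trunc_rev_msym_lift.
by rewrite kill_var_schubert_lift.
Qed.
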